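(* Let $0<a<1$ and let $b$ be an odd integer such that $ab > 1+\frac{3}{2}\pi$. Let $M > 0$ and $N \in \mathbb{N}$ be fixed. Let $\alpha_m = b^m \pi$ and define $$K_{\max} = \frac{(\alpha_N^2 - 1)M^2}{2}.$$ For any integer $n \ge \max\left( \frac{4M}{\pi}, K_{\max} \right)$, $$\sup_{|x|\leq M} |W_N(x) - \mathcal{W}_{N,n}(x)| \leq \frac{e}{n} \mathcal{S}_1(N) + \frac{\sqrt{e}}{n^2} \mathcal{S}_2(N),$$ where $$\mathcal{S}_1(N) = \frac{M^2}{2} \left[ \pi^2 \frac{(ab^2)^{N+1}-1}{ab^2-1} - \frac{1-a^{N+1}}{1-a} \right],$$ $$\mathcal{S}_2(N) = 2M^3 \left[ \pi^3 \frac{(ab^3)^{N+1}-1}{ab^3-1} - \pi \frac{(ab)^{N+1}-1}{ab-1} \right].$$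
   Context: For real $x$, the truncated Weierstrass function is $$W_N(x) = \sum_{m=0}^{N} a^m e^{i \alpha_m x}, \qquad \alpha_m = b^m\pi,$$ and its superoscillating approximation of order $n$ (a positive integer) is $$\mathcal{W}_{N,n}(x) = \sum_{m=0}^{N} a^m \left[ \cos\left(\frac{x}{n}\right) + i \alpha_m \sin\left(\frac{x}{n}\right) \right]^n .$$ The supremum is over real $x$ with $|x|\le M$. *)

(* Defs.v *)
From Stdlib Require Import Reals ZArith.
From Coquelicot Require Import Coquelicot.

Local Open Scope R_scope.

(* Coquelicot has no complex exponential:
   e^(u + iv) = e^u (cos v + i sin v). *)
Definition Cexp (z : C) : C :=
  (exp (Re z) * cos (Im z), exp (Re z) * sin (Im z)).

Definition alpha (b : Z) (m : nat) : R := IZR b ^ m * PI.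

(* [sum_n u N] is u 0 + ... + u N, both ends included. *)
Definition weierstrass (a : R) (b : Z) (N : nat) (x : R) : C :=
  sum_n (fun m => (RtoC (a ^ m) * Cexp (Ci * RtoC (alpha b m * x)))%C) N.

Definition weierstrass_so (a : R) (b : Z) (N n : nat) (x : R) : C :=
  sum_n (fun m =>
    (RtoC (a ^ m) *
     (RtoC (cos (x / INR n)) +
      Ci * RtoC (alpha b m) * RtoC (sin (x / INR n))) ^ n)%C) N.

Definition Kmax (b : Z) (M : R) (N : nat) : R :=
  (alpha b N ^ 2 - 1) * M ^ 2 / 2.

Definition S1 (a : R) (b : Z) (M : R) (N : nat) : R :=
  M ^ 2 / 2 *
  (PI ^ 2 * (((a * IZR b ^ 2) ^ (N + 1) - 1) / (a * IZR b ^ 2 - 1))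
   - (1 - a ^ (N + 1)) / (1 - a)).

Definition S2 (a : R) (b : Z) (M : R) (N : nat) : R :=
  2 * M ^ 3 *
  (PI ^ 3 * (((a * IZR b ^ 3) ^ (N + 1) - 1) / (a * IZR b ^ 3 - 1))
   - PI * (((a * IZR b) ^ (N + 1) - 1) / (a * IZR b - 1))).

(* The supremum is taken in the extended reals, so that bounding it also
   asserts that the set of values is bounded. *)
Definition sup_on (M : R) (f : R -> R) : Rbar :=
  Lub_Rbar (fun y => exists x : R, Rabs x <= M /\ y = f x).

(* Main.v *)
Require Import Defs.
From Stdlib Require Import Reals ZArith.
From Coquelicot Require Import Coquelicot.
From Stdlib Require Import Lra Lia.

(** Fix a frequency [al >= 1] and put [t = x / n], [w = e^(i al t)] and
    [z = cos t + i al sin t], so that the two functions contribute [w ^ n] and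
    [z ^ n] at this frequency.  Three facts combine.

    - [z] is close to [w]: the real parts differ by at most
      [(al^2 - 1) t^2 / 2] (sum-to-product formula), and the imaginary parts by
      at most [al (al^2 - 1) |t|^3 / 2], since the derivative of
      [al sin t - sin (al t)] is [al] times the difference of the real parts.
    - [z] is barely outside the unit disc:
      [|z|^2 = 1 + (al^2 - 1) sin^2 t <= 1 + 2 / n <= exp (2 / n)] as soon as
      [(al^2 - 1) x^2 / 2 <= n], so that all the powers [|z|^k], [k <= n], stay
      below [e].
    - [w ^ n - z ^ n] is [w - z] times a sum of [n] products of powers of [w]
      and [z], whence [|w ^ n - z ^ n| <= n e |w - z|].

    The frequencies [alpha b m] increase with [m], so the condition
    [Kmax b M N <= n] supplies [(al^2 - 1) x^2 / 2 <= n] for all of them at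
    once.  Summing with weights [a^m] gives the two terms of the bound, because
    [S1] and [S2] are the closed forms of the geometric sums of
    [a^m (alpha_m^2 - 1)] and [a^m (alpha_m^3 - alpha_m)].  The constant of the
    second term has room to spare: the argument yields [e / 2] and [2 sqrt e]
    is available. *)

Local Open Scope R_scope.

(** * Trigonometric estimates *)

Lemma Rabs_sin_le (y : R) : Rabs (sin y) <= Rabs y.
Proof.
  destruct (MVT_gen sin 0 y cos) as [c [_ hc]].
  - intros u _. apply is_derive_sin.
  - intros u _. apply continuity_sin.
  - rewrite sin_0, !Rminus_0_r in hc. rewrite hc, Rabs_mult.
    assert (h : Rabs (cos c) <= 1) by (apply Rabs_le, COS_bound).
    pose proof (Rabs_pos y). nra.
Qed.

Lemma sin_sq_le (y : R) : sin y ^ 2 <= y ^ 2.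
Proof.
  rewrite <- (pow2_abs (sin y)), <- (pow2_abs y).
  apply pow_incr; split; [apply Rabs_pos | apply Rabs_sin_le].
Qed.

(** The sum-to-product formula turns the difference into a product of two sines
    of the half-sum and the half-difference, each bounded by its argument. *)
Lemma cos_scale_diff (al t : R) (hal : 1 <= al) :
  Rabs (cos (al * t) - cos t) <= (al ^ 2 - 1) * t ^ 2 / 2.
Proof.
  rewrite form2, !Rabs_mult.
  pose proof (Rabs_sin_le ((al * t - t) / 2)) as h1.
  pose proof (Rabs_sin_le ((al * t + t) / 2)) as h2.
  replace ((al * t - t) / 2) with ((al - 1) / 2 * t) in * by field.
  replace ((al * t + t) / 2) with ((al + 1) / 2 * t) in * by field.
  rewrite Rabs_mult, (Rabs_pos_eq ((al - 1) / 2)) in h1 by lra.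
  rewrite Rabs_mult, (Rabs_pos_eq ((al + 1) / 2)) in h2 by lra.
  replace (Rabs (-2)) with 2 by (rewrite Rabs_left; lra).
  rewrite <- (pow2_abs t).
  replace ((al ^ 2 - 1) * Rabs t ^ 2 / 2)
    with (2 * ((al - 1) / 2 * Rabs t) * ((al + 1) / 2 * Rabs t)) by field.
  rewrite !Rmult_assoc. apply Rmult_le_compat_l; [lra|].
  rewrite <- !Rmult_assoc, (Rmult_assoc ((al - 1) / 2 * Rabs t)).
  apply Rmult_le_compat; auto using Rabs_pos.
Qed.

(** The mean value theorem at [0]: the derivative of the difference is
    [al (cos (al t) - cos t)], which [cos_scale_diff] controls. *)
Lemma sin_scale_diff (al t : R) (hal : 1 <= al) :
  Rabs (sin (al * t) - al * sin t) <= (al ^ 3 - al) * Rabs t ^ 3 / 2.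
Proof.
  destruct (MVT_gen (fun u => sin (al * u) - al * sin u) 0 t
              (fun u => al * (cos (al * u) - cos u))) as [c [hcr hc]].
  - intros u _. auto_derive; [trivial | ring].
  - intros u _. apply derivable_continuous_pt.
    exists (al * (cos (al * u) - cos u)). apply is_derive_Reals.
    auto_derive; [trivial | ring].
  - rewrite Rmult_0_r, sin_0, Rmult_0_r, !Rminus_0_r in hc.
    rewrite hc, !Rabs_mult, (Rabs_pos_eq al) by lra.
    assert (hct : Rabs c <= Rabs t).
    { revert hcr. unfold Rmin, Rmax.
      destruct (Rle_dec 0 t); intros; split_Rabs; lra. }
    assert (h2 : c ^ 2 <= Rabs t ^ 2).
    { rewrite <- (pow2_abs c). apply pow_incr. split; [apply Rabs_pos | exact hct]. }
    assert (h : Rabs (cos (al * c) - cos c) <= (al ^ 2 - 1) * Rabs t ^ 2 / 2).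
    { eapply Rle_trans; [apply cos_scale_diff, hal|].
      assert (0 <= al ^ 2 - 1) by nra. nra. }
    replace ((al ^ 3 - al) * Rabs t ^ 3 / 2)
      with (al * ((al ^ 2 - 1) * Rabs t ^ 2 / 2) * Rabs t) by field.
    apply Rmult_le_compat_r; [apply Rabs_pos|].
    apply Rmult_le_compat_l; lra.
Qed.

(** * Powers of complex numbers *)

Lemma Cmod_le_Rabs (u v : R) : Cmod (u, v) <= Rabs u + Rabs v.
Proof.
  replace (u, v) with (RtoC u + Ci * RtoC v)%C
    by (apply injective_projections; simpl; ring).
  eapply Rle_trans; [apply Cmod_triangle|].
  rewrite Cmod_mult, Cmod_Ci, !Cmod_R. lra.
Qed.

(** Telescoping: [w^(k+1) - z^(k+1) = w (w^k - z^k) + (w - z) z^k]. *)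
Lemma Cmod_pow_diff (w z : C) (r : R) (n : nat) :
  1 <= r -> Cmod w <= r -> Cmod z <= r ->
  Cmod (w ^ n - z ^ n)%C <= INR n * Cmod (w - z)%C * r ^ n.
Proof.
  intros hr hw hz. induction n as [|n IH].
  - simpl. replace (1 - 1)%C with (RtoC 0) by ring. rewrite Cmod_0. lra.
  - rewrite !Cpow_S, S_INR.
    replace (w * w ^ n - z * z ^ n)%C
      with (w * (w ^ n - z ^ n) + (w - z) * z ^ n)%C by ring.
    eapply Rle_trans; [apply Cmod_triangle|].
    rewrite !Cmod_mult, Cmod_pow.
    pose proof (Cmod_ge_0 (w - z)) as hd.
    pose proof (pow_R1_Rle r n hr) as hrn.
    assert (h1 : Cmod w * Cmod (w ^ n - z ^ n) <=
                 r * (INR n * Cmod (w - z) * r ^ n))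
      by (apply Rmult_le_compat; auto using Cmod_ge_0).
    assert (h2 : Cmod z ^ n <= r * r ^ n).
    { apply Rle_trans with (r ^ n); [|nra].
      apply pow_incr; split; [apply Cmod_ge_0 | exact hz]. }
    pose proof (Rmult_le_compat_l _ _ _ hd h2). simpl. lra.
Qed.

Lemma Cexp_Ci (u : R) : Cexp (Ci * RtoC u)%C = (cos u, sin u).
Proof.
  unfold Cexp.
  replace (Re (Ci * RtoC u)) with 0 by (simpl; ring).
  replace (Im (Ci * RtoC u)) with u by (simpl; ring).
  rewrite exp_0, !Rmult_1_l. reflexivity.
Qed.

Lemma de_Moivre (t : R) (n : nat) :
  ((cos t, sin t) ^ n)%C = (cos (INR n * t), sin (INR n * t)).
Proof.
  induction n as [|n IH].
  - simpl. rewrite Rmult_0_l, cos_0, sin_0. reflexivity.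
  - rewrite Cpow_S, IH, S_INR, Rmult_plus_distr_r, Rmult_1_l, cos_plus, sin_plus.
    apply injective_projections; simpl; ring.
Qed.

Lemma Cmod_cos_sin (t : R) : Cmod (cos t, sin t) = 1.
Proof.
  unfold Cmod; simpl fst; simpl snd.
  replace (cos t ^ 2 + sin t ^ 2) with 1
    by (pose proof (sin2_cos2 t); unfold Rsqr in *; lra).
  apply sqrt_1.
Qed.

Lemma exp_pow_INR (y : R) (n : nat) : exp y ^ n = exp (INR n * y).
Proof.
  induction n as [|n IH].
  - now rewrite Rmult_0_l, exp_0.
  - rewrite S_INR, Rmult_plus_distr_r, exp_plus, Rmult_1_l, <- IH. simpl. ring.
Qed.

(** * The error at a single frequency *)

(** [|z|^2 = 1 + (al^2 - 1) sin^2 t], and [1 + 2 h <= exp (2 h)]. *)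
Lemma Cmod_superosc_le (al t h : R) :
  1 <= al -> (al ^ 2 - 1) * t ^ 2 <= 2 * h ->
  Cmod (cos t, al * sin t) <= exp h.
Proof.
  intros hal hh. unfold Cmod; simpl fst; simpl snd.
  rewrite <- (sqrt_pow2 (exp h)) by (left; apply exp_pos).
  apply sqrt_le_1_alt.
  rewrite exp_pow_INR. simpl INR.
  eapply Rle_trans; [|apply exp_ineq1_le].
  pose proof (sin2_cos2 t) as hsc. unfold Rsqr in hsc.
  pose proof (sin_sq_le t). assert (0 <= al ^ 2 - 1) by nra. nra.
Qed.

Lemma superosc_frequency_error (al x : R) (n : nat) :
  1 <= al -> 0 < INR n -> (al ^ 2 - 1) * x ^ 2 <= 2 * INR n ->
  Cmod (Cexp (Ci * RtoC (al * x)) -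
        (RtoC (cos (x / INR n)) + Ci * RtoC al * RtoC (sin (x / INR n))) ^ n)%C
  <= exp 1 / INR n * ((al ^ 2 - 1) * x ^ 2 / 2)
     + exp 1 / INR n ^ 2 * ((al ^ 3 - al) * Rabs x ^ 3 / 2).
Proof.
  intros hal hn hx. set (t := x / INR n).
  assert (ht : x = INR n * t) by (unfold t; field; lra).
  replace (RtoC (cos t) + Ci * RtoC al * RtoC (sin t))%C with (cos t, al * sin t)
    by (apply injective_projections; simpl; ring).
  rewrite Cexp_Ci.
  replace (al * x) with (INR n * (al * t)) by (rewrite ht; ring).
  rewrite <- de_Moivre.
  assert (hin : 0 < / INR n) by (apply Rinv_0_lt_compat, hn).
  assert (hr : 1 <= exp (/ INR n))
    by (pose proof (exp_ineq1_le (/ INR n)); lra).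
  eapply Rle_trans.
  { apply (Cmod_pow_diff _ _ (exp (/ INR n))); [exact hr | |].
    - rewrite Cmod_cos_sin. exact hr.
    - apply Cmod_superosc_le; [exact hal|].
      apply Rmult_le_reg_l with (INR n ^ 2); [nra|].
      replace (INR n ^ 2 * (2 * / INR n)) with (2 * INR n) by (field; lra).
      rewrite ht in hx. nra. }
  rewrite exp_pow_INR, Rinv_r by lra.
  assert (hd : Cmod ((cos (al * t)%R, sin (al * t)%R) - (cos t, (al * sin t)%R))%C <=
               (al ^ 2 - 1) * t ^ 2 / 2 + (al ^ 3 - al) * Rabs t ^ 3 / 2).
  { eapply Rle_trans; [apply Cmod_le_Rabs|]. simpl.
    apply Rplus_le_compat; [apply cos_scale_diff | apply sin_scale_diff]; exact hal. }
  apply Rle_trans with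
    (INR n * ((al ^ 2 - 1) * t ^ 2 / 2 + (al ^ 3 - al) * Rabs t ^ 3 / 2) * exp 1).
  { apply Rmult_le_compat_r; [left; apply exp_pos|].
    apply Rmult_le_compat_l; [lra | exact hd]. }
  rewrite ht, Rabs_mult, (Rabs_pos_eq (INR n)) by lra.
  right. field. lra.
Qed.

(** * Summation over the frequencies *)

Lemma Cmod_sum_diff_le (u v : nat -> C) (c : nat -> R) (N : nat) :
  (forall m, (m <= N)%nat -> Cmod (u m - v m)%C <= c m) ->
  Cmod (sum_n u N - sum_n v N)%C <= sum_n c N.
Proof.
  induction N as [|N IH]; intros h.
  - rewrite !sum_O. apply h. lia.
  - rewrite !sum_Sn.
    change (Cmod (sum_n u N + u (S N) - (sum_n v N + v (S N)))%C <= sum_n c N + c (S N)).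
    replace (sum_n u N + u (S N) - (sum_n v N + v (S N)))%C
      with ((sum_n u N - sum_n v N) + (u (S N) - v (S N)))%C by ring.
    eapply Rle_trans; [apply Cmod_triangle|].
    apply Rplus_le_compat; [apply IH; intros m hm|]; apply h; lia.
Qed.

Lemma geometric_sum (q : R) (N : nat) :
  q <> 1 -> (q ^ (N + 1) - 1) / (q - 1) = sum_n (fun m => q ^ m) N.
Proof.
  intros hq. rewrite sum_n_Reals, tech3 by exact hq.
  rewrite Nat.add_1_r. field. lra.
Qed.

Lemma sum_n_lin (p q : R) (u v : nat -> R) (N : nat) :
  p * sum_n u N + q * sum_n v N = sum_n (fun m => p * u m + q * v m) N.
Proof.
  induction N as [|N IH].
  - now rewrite !sum_O.
  - rewrite !sum_Sn, <- IH. unfold plus; simpl. ring.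
Qed.

Lemma S1_sum (a : R) (b : Z) (M : R) (N : nat) :
  a <> 1 -> a * IZR b ^ 2 <> 1 ->
  S1 a b M N = sum_n (fun m => M ^ 2 / 2 * (a ^ m * (alpha b m ^ 2 - 1))) N.
Proof.
  intros h1 h2. unfold S1, alpha.
  replace ((1 - a ^ (N + 1)) / (1 - a)) with ((a ^ (N + 1) - 1) / (a - 1))
    by (field; split; lra).
  rewrite !geometric_sum by assumption.
  transitivity (M ^ 2 / 2 * PI ^ 2 * sum_n (fun m => (a * IZR b ^ 2) ^ m) N
                + - (M ^ 2 / 2) * sum_n (fun m => a ^ m) N); [ring|].
  rewrite sum_n_lin. apply sum_n_ext. intros m.
  match goal with |- ?u = ?v => change (@eq R u v) end.
  rewrite !Rpow_mult_distr, <- !pow_mult, (Nat.mul_comm m). ring.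
Qed.

Lemma S2_sum (a : R) (b : Z) (M : R) (N : nat) :
  a * IZR b <> 1 -> a * IZR b ^ 3 <> 1 ->
  S2 a b M N =
  sum_n (fun m => 2 * M ^ 3 * (a ^ m * (alpha b m ^ 3 - alpha b m))) N.
Proof.
  intros h1 h3. unfold S2, alpha.
  rewrite !geometric_sum by assumption.
  transitivity (2 * M ^ 3 * PI ^ 3 * sum_n (fun m => (a * IZR b ^ 3) ^ m) N
                + - (2 * M ^ 3 * PI) * sum_n (fun m => (a * IZR b) ^ m) N); [ring|].
  rewrite sum_n_lin. apply sum_n_ext. intros m.
  match goal with |- ?u = ?v => change (@eq R u v) end.
  rewrite !Rpow_mult_distr, <- !pow_mult, (Nat.mul_comm m). ring.
Qed.

Lemma exp_1_le_4_sqrt : exp 1 <= 4 * sqrt (exp 1).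
Proof.
  pose proof exp_le_3 as h3. pose proof (exp_pos 1) as h0.
  pose proof (sqrt_sqrt (exp 1)) as hs. pose proof (sqrt_pos (exp 1)). nra.
Qed.

Lemma alpha_mono (b : Z) (m N : nat) :
  1 <= IZR b -> (m <= N)%nat -> 1 <= alpha b m <= alpha b N.
Proof.
  intros hb hm. unfold alpha.
  assert (hPI : 3 < PI) by (pose proof PI2_3_2; lra).
  pose proof (pow_R1_Rle _ m hb). pose proof (Rle_pow _ _ _ hb hm). nra.
Qed.

Theorem theorem2p5 (a : R) (b : Z) (M : R) (N n : nat)
  (ha0 : 0 < a) (ha1 : a < 1)
  (hb : Z.Odd b) (hab : a * IZR b > 1 + 3 / 2 * PI)
  (hM : 0 < M)
  (hn : INR n >= Rmax (4 * M / PI) (Kmax b M N)) :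
  Rbar_le
    (sup_on M (fun x => Cmod (weierstrass a b N x - weierstrass_so a b N n x)%C))
    (Finite (exp 1 / INR n * S1 a b M N
             + sqrt (exp 1) / INR n ^ 2 * S2 a b M N)).
Proof.
  pose proof PI_RGT_0 as hPI.
  assert (hb1 : 1 < IZR b) by nra.
  assert (hn0 : 0 < INR n).
  { pose proof (Rmax_l (4 * M / PI) (Kmax b M N)).
    assert (0 < 4 * M / PI) by (apply Rdiv_lt_0_compat; lra). lra. }
  assert (hK : Kmax b M N <= INR n)
    by (pose proof (Rmax_r (4 * M / PI) (Kmax b M N)); lra).
  unfold Kmax in hK.
  assert (hab2 : 1 < a * IZR b ^ 2) by nra.
  assert (hab3 : 1 < a * IZR b ^ 3) by nra.
  rewrite S1_sum, S2_sum, sum_n_lin by lra.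
  apply (proj2 (Lub_Rbar_correct _)). intros y [x [hx ->]]. simpl.
  assert (hx2 : x ^ 2 <= M ^ 2)
    by (rewrite <- pow2_abs; apply pow_incr; split; [apply Rabs_pos | exact hx]).
  assert (hx3 : Rabs x ^ 3 <= M ^ 3)
    by (apply pow_incr; split; [apply Rabs_pos | exact hx]).
  unfold weierstrass, weierstrass_so. apply Cmod_sum_diff_le. intros m hm.
  destruct (alpha_mono b m N) as [hal halN]; [lra | exact hm |].
  set (al := alpha b m) in *.
  assert (hal2 : 0 <= al ^ 2 - 1) by nra.
  assert (hal3 : 0 <= al ^ 3 - al) by nra.
  assert (hcond : (al ^ 2 - 1) * x ^ 2 <= 2 * INR n).
  { assert (al ^ 2 <= alpha b N ^ 2) by (apply pow_incr; lra).
    assert ((al ^ 2 - 1) * x ^ 2 <= (alpha b N ^ 2 - 1) * M ^ 2)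
      by (apply Rmult_le_compat; nra).
    lra. }
  pose proof (superosc_frequency_error al x n hal hn0 hcond) as herr.
  match goal with |- Cmod (RtoC ?c * ?w - RtoC ?c * ?z)%C <= _ =>
    replace (RtoC c * w - RtoC c * z)%C with (RtoC c * (w - z))%C by ring
  end.
  rewrite Cmod_mult, Cmod_R.
  assert (ham : 0 < a ^ m) by (apply pow_lt, ha0).
  rewrite Rabs_pos_eq by lra.
  apply Rle_trans with
    (a ^ m * (exp 1 / INR n * ((al ^ 2 - 1) * M ^ 2 / 2)
              + sqrt (exp 1) / INR n ^ 2 * (2 * ((al ^ 3 - al) * M ^ 3))));
    [|right; field; lra].
  apply Rmult_le_compat_l; [lra|].
  eapply Rle_trans; [exact herr|]. apply Rplus_le_compat.
  - apply Rmult_le_compat_l.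
    + apply Rlt_le, Rdiv_lt_0_compat; [apply exp_pos | exact hn0].
    + nra.
  - unfold Rdiv at 1 3. rewrite !(Rmult_comm _ (/ INR n ^ 2)), !Rmult_assoc.
    apply Rmult_le_compat_l; [left; apply Rinv_0_lt_compat; nra|].
    assert (hx3' : (al ^ 3 - al) * Rabs x ^ 3 <= (al ^ 3 - al) * M ^ 3)
      by (apply Rmult_le_compat_l; assumption).
    assert (0 <= (al ^ 3 - al) * M ^ 3)
      by (apply Rmult_le_pos; [assumption | apply pow_le; lra]).
    pose proof exp_1_le_4_sqrt. pose proof (exp_pos 1). nra.
Qed.
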